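(* Consider the distributed fair $k$-center algorithm described below on a finite metric space $(X,d)$ with $|X|=n$, group assignment $g:X\to\{1,\dots,m\}$, capacities $k_1,\dots,k_m$ with $k=\sum_jk_j$, and $\tau\ge\mathrm{OPT}$, where $X$ is split equally among $\ell$ processors ($|X_i|=n/\ell\ge k+1$). Assuming each distance evaluation and group lookup takes constant time, the running time of the algorithm (the maximum running time of a processor plus the running time of the coordinator) is $O(kn/\ell+mk^2\ell)$. Choosing $\ell=\Theta(\sqrt{n/(mk)})$, this is $O(m^{1/2}k^{3/2}n^{1/2})$. Algorithm. Each processor $i$: picks $p^i_1\in X_i$ arbitrarily; for $j=2,\dots,k+1$ sets $p^i_j\in\arg\max_{p\in X_i}\min_{1\le j'<j}d(p,p^i_{j'})$; $P_i=\{p^i_1,\dots,p^i_k\}$; $r_i=\min_{1\le j'\le k}d(p^i_{k+1},p^i_{j'})/2$; for each $p\in P_i$ builds $L(p)$ by initializing $L(p)=\{p\}$ and in one scan of $X_i$ adding $x$ whenever $d(p,x)\le2r_i$ and $L(p)$ has no point of group $g(x)$; sends $(P_i,L_i)$ with $L_i=\bigcup_{p\in P_i}L(p)$. The coordinator: with $X'=\bigcup_iP_i$ and $L=\bigcup_iL_i$, computes $P$ by one scan of $X'$ (start with the first point, add $q$ whenever $\min_{p\in P}d(p,q)>10\tau$); for each $q\in P$ builds $N(q)$ by initializing $N(q)=\{q\}$ and in one scan of $L$ adding $x$ whenever $d(q,x)\le5\tau$ and $N(q)$ has no point of group $g(x)$; finally computes a feasible subset of $\bigcup_{q\in P}N(q)$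 intersecting as many $N(q)$ as possible, by building the flow network with a source joined by unit-capacity arcs to one node per set $N(q)$, an arc from the node of $N(q)$ to a node for group $j$ whenever $N(q)$ contains a point of group $j$, and an arc of capacity $k_j$ from group node $j$ to a sink, computing an integral maximum flow with the Ford–Fulkerson algorithm, and selecting, for every arc from $N(q)$ to group $j$ carrying flow, the point of $N(q)$ of group $j$.
   Context: For nonempty $A,B\subseteq X$, the clustering cost of $A$ for $B$ is $\max_{b\in B}\min_{a\in A}d(a,b)$. A set $S\subseteq X$ is feasible if for every group $j$ it contains at most $k_j$ points of group $j$. $\mathrm{OPT}$ is the minimum over feasible $S$ of the clustering cost of $S$ for $X$. *)

(* Defs.v *)
From HB Require Import structures.
From mathcomp Require Import all_boot all_order all_algebra.
From mathcomp Require Import reals constructive_ereal exp.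

Set Implicit Arguments.
Unset Strict Implicit.
Unset Printing Implicit Defensive.

Import Order.TTheory GRing.Theory Num.Theory.
Local Open Scope ring_scope.

(** * Cost model

  Programs of a unit-cost RAM are written in the delay monad: each [Later] is
  one time step, and the running time of a terminating program is the number of
  [Later]s in front of its result.  A program that does not terminate is an
  infinite sequence of [Later]s and has no running time.

  Everything that inspects or produces data is charged:
  - [op v] evaluates one primitive operation (a distance evaluation, a group
    lookup, an arithmetic operation or a comparison, a read or a write of an
    array cell) in one step;
  - every iteration of a loop or of a recursion costs one step, on top of the
    cost of its body, which pays for the control flow and for the bounded
    amount of pairing and consing done in that iteration.
  Programs below are built from these combinators only.  Arrays are sequences
  used single-threadedly: an updated array replaces the old one. *)

CoInductive delay (A : Type) : Type :=
  | Now of A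
  | Later of delay A.

Inductive takes (A : Type) : delay A -> A -> nat -> Prop :=
  | takes_now a : takes (Now a) a 0
  | takes_later p a t : takes p a t -> takes (Later p) a t.+1.

Lemma takes_inj (A : Type) (p : delay A) a1 a2 t1 t2 :
  takes p a1 t1 -> takes p a2 t2 -> a1 = a2 /\ t1 = t2.
Proof.
move=> h; elim: h a2 t2 => [a|q a t _ IH] a2 t2 h2.
  by inversion h2.
by inversion h2 as [|? ? ? h3]; subst; have [-> ->] := IH _ _ h3.
Qed.

CoFixpoint bind (A B : Type) (p : delay A) (f : A -> delay B) : delay B :=
  match p with
  | Now a => f a
  | Later q => Later (bind q f)
  end.

Notation "'let*' x ':=' p 'in' q" := (bind p (fun x => q))
  (at level 200, x binder, p at level 100, q at level 200,
   format "'[v' 'let*'  x  ':='  p  'in' '/' q ']'").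

Definition op (A : Type) (v : A) : delay A := Later (Now v).

Fixpoint foreach (S A : Type) (body : S -> A -> delay S) (s : S) (l : seq A)
    : delay S :=
  Later (if l is x :: l' then
           let* s' := body s x in foreach body s' l'
         else Now s).

Fixpoint mapM (A B : Type) (f : A -> delay B) (l : seq A) : delay (seq B) :=
  Later (if l is x :: l' then
           let* y := f x in
           let* ys := mapM f l' in
           Now (y :: ys)
         else Now [::]).

(* A counter loop: [iota] is never materialized, the step charged per iteration
   by [foreach] pays for the increment. *)
Definition for_upto (S : Type) (n : nat) (body : S -> nat -> delay S) (s : S)
    : delay S :=
  foreach body s (iota 0 n).

CoFixpoint loop_from (S A : Type) (body : S -> delay (S + A))
    (p : delay (S + A)) : delay A :=
  match p with
  | Now (inl s) => Later (loop_from body (body s))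
  | Now (inr a) => Now a
  | Later q => Later (loop_from body q)
  end.

(* Unbounded iteration: runs [body] until it answers [inr]. *)
Definition loop (S A : Type) (body : S -> delay (S + A)) (s : S) : delay A :=
  Later (loop_from body (body s)).

Fixpoint array_new (A : Type) (n : nat) (x : A) : delay (seq A) :=
  Later (if n is n'.+1 then
           let* a := array_new n' x in Now (x :: a)
         else Now [::]).

Definition array_get (A : Type) (x0 : A) (a : seq A) (i : nat) : delay A :=
  op (nth x0 a i).

Definition array_set (A : Type) (x0 : A) (a : seq A) (i : nat) (x : A)
    : delay (seq A) :=
  op (set_nth x0 a i x).

Definition lengthM (A : Type) (l : seq A) : delay nat :=
  foreach (fun c _ => op c.+1) 0%N l.

Fixpoint catM (A : Type) (l1 l2 : seq A) : delay (seq A) :=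
  Later (if l1 is x :: l1' then
           let* l := catM l1' l2 in Now (x :: l)
         else Now l2).

Fixpoint flattenM (A : Type) (ls : seq (seq A)) : delay (seq A) :=
  Later (if ls is l :: ls' then
           let* r := flattenM ls' in catM l r
         else Now [::]).

(** * The Ford-Fulkerson algorithm

  Residual networks in adjacency-list form.  Arcs are numbered; arc [2 i] is an
  arc of the network and arc [2 i + 1] is its reverse.  The residual capacity
  of [2 i] is its capacity minus its flow, that of [2 i + 1] is the flow of
  [2 i]. *)

Record network := Network {
  num_nodes : nat;
  arc_head : seq nat;
  residual : seq nat;
  adjacency : seq (seq nat)   (* numbers of the arcs leaving each node *)
}.

Definition set_residual (N : network) (r : seq nat) : network :=
  Network (num_nodes N) (arc_head N) r (adjacency N).

Definition empty_network (nodes arcs : nat) : delay network :=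
  let* arcs2 := op (2 * arcs)%N in
  let* hd := array_new arcs2 0%N in
  let* rs := array_new arcs2 0%N in
  let* ad := array_new nodes [::] in
  Now (Network nodes hd rs ad).

Definition reverse_arc (e : nat) : delay nat :=
  op (if odd e then e.-1 else e.+1).

(* Adds an arc from [u] to [v] of capacity [c] under the first unused arc
   number [e]; returns the next unused number. *)
Definition add_arc (N : network) (e u v c : nat) : delay (network * nat) :=
  let* e' := reverse_arc e in
  let* hd := array_set 0%N (arc_head N) e v in
  let* hd := array_set 0%N hd e' u in
  let* rs := array_set 0%N (residual N) e c in
  let* rs := array_set 0%N rs e' 0%N in
  let* au := array_get [::] (adjacency N) u in
  let* ad := array_set [::] (adjacency N) u (e :: au) in
  let* av := array_get [::] ad v in
  let* ad := array_set [::] ad v (e' :: av) in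
  let* next := op e.+2 in
  Now (Network (num_nodes N) hd rs ad, next).

(* Depth-first search from [s] along the arcs of positive residual capacity.
   Returns the array of visited nodes and, for every visited node other than
   [s], the arc through which it was reached. *)
Definition search (N : network) (s : nat) : delay (seq bool * seq nat) :=
  let* seen := array_new (num_nodes N) false in
  let* parent := array_new (num_nodes N) 0%N in
  let* seen := array_set false seen s true in
  loop (fun st : seq nat * seq bool * seq nat =>
      let: (stack, seen, parent) := st in
      if stack is u :: stack' then
        let* es := array_get [::] (adjacency N) u in
        let* st' := foreach (fun (st : seq nat * seq bool * seq nat) e =>
            let: (stack, seen, parent) := st in
            let* r := array_get 0%N (residual N) e in
            let* v := array_get 0%N (arc_head N) e in
            let* seen_v := array_get false seen v in
            let* new := op ((0 < r)%N && ~~ seen_v) in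
            if new then
              let* seen := array_set false seen v true in
              let* parent := array_set 0%N parent v e in
              Now (v :: stack, seen, parent)
            else Now st)
          (stack', seen, parent) es in
        Now (inl st')
      else Now (inr (seen, parent)))
    ([:: s], seen, parent).

(* The arcs of the path from [s] to [t] recorded in [parent]. *)
Definition trace_path (N : network) (parent : seq nat) (s t : nat)
    : delay (seq nat) :=
  loop (fun st : nat * seq nat =>
      let: (v, path) := st in
      let* stop := op (v == s) in
      if stop then Now (inr path)
      else
        let* e := array_get 0%N parent v in
        let* e' := reverse_arc e in
        let* u := array_get 0%N (arc_head N) e' in
        Now (inl (u, e :: path)))
    (t, [::]).

Definition augment (N : network) (path : seq nat) : delay network :=
  let* bottleneck := foreach (fun (b : option nat) e =>
      let* r := array_get 0%N (residual N) e in
      op (Some (if b is Some b' then minn b' r else r)))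
    None path in
  let: b := odflt 0%N bottleneck in
  let* rs := foreach (fun rs e =>
      let* r := array_get 0%N rs e in
      let* r := op (r - b)%N in
      let* rs := array_set 0%N rs e r in
      let* e' := reverse_arc e in
      let* r' := array_get 0%N rs e' in
      let* r' := op (r' + b)%N in
      array_set 0%N rs e' r')
    (residual N) path in
  Now (set_residual N rs).

Definition ford_fulkerson (N : network) (s t : nat) : delay network :=
  loop (fun N =>
      let* sp := search N s in
      let: (seen, parent) := sp in
      let* reached := array_get false seen t in
      if reached then
        let* path := trace_path N parent s t in
        let* N' := augment N path in
        Now (inl N')
      else Now (inr N))
    N.

Section Algorithm.
Context (R : realFieldType) (X : Type) (d : X -> X -> R).
Context (m : nat) (g : X -> nat).   (* groups are numbered 0, ..., m - 1 *)

(* A set of points with at most one point per group is an array with one cell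
   per group, so that looking for a point of a given group is one array read.
   [representatives p rad l] starts from {p} and scans [l], adding [x] whenever
   [d p x <= rad] and no point of the group of [x] is present. *)
Definition representatives (p : X) (rad : R) (l : seq X)
    : delay (seq (option X)) :=
  let* T := array_new m None in
  let* gp := op (g p) in
  let* T := array_set None T gp (Some p) in
  foreach (fun T x =>
      let* dpx := op (d p x) in
      let* close := op (dpx <= rad) in
      if close then
        let* gx := op (g x) in
        let* y := array_get None T gx in
        if y is Some _ then Now T else array_set None T gx (Some x)
      else Now T)
    T l.

Fixpoint list_of_table (T : seq (option X)) : delay (seq X) :=
  Later (if T is o :: T' then
           let* l := list_of_table T' in
           Now (if o is Some x then x :: l else l)
         else Now [::]).

(* [D] lists the local points with their distance to the points selected so
   far.  [tie j b x] decides whether, in round [j], a point [x] at the same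
   distance as the current best [b] replaces it: every choice of an element of
   the argmax is obtained for some [tie].  [dflt] is only used for empty [D]. *)
Definition farthest (tie : nat -> X -> X -> bool) (j : nat) (dflt : X * R)
    (D : seq (X * R)) : delay (X * R) :=
  foreach (fun (best : X * R) (xd : X * R) =>
      let: (b, db) := best in
      let: (x, dx) := xd in
      let* gt := op (db < dx) in
      let* eq := op (db == dx) in
      let* t := op (tie j b x) in
      Now (if gt || (eq && t) then xd else best))
    (head dflt D) (behead D).

Definition update_distances (p : X) (D : seq (X * R)) : delay (seq (X * R)) :=
  mapM (fun xd : X * R =>
      let: (x, dx) := xd in
      let* dxp := op (d x p) in
      let* lt := op (dxp < dx) in
      Now (x, if lt then dxp else dx))
    D.

(* Rounds [j, ..., j + c - 1]: the selected points and the final distances. *)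
Fixpoint select_farthest (tie : nat -> X -> X -> bool) (dflt : X * R)
    (c j : nat) (D : seq (X * R)) : delay (seq X * seq (X * R)) :=
  Later (if c is c'.+1 then
           let* pd := farthest tie j dflt D in
           let* D := update_distances pd.1 D in
           let* rest := select_farthest tie dflt c' j.+1 D in
           Now (pd.1 :: rest.1, rest.2)
         else Now ([::], D)).

(* The message (P_i, L_i) of a processor holding the points [Xi], with first
   point [p1].  The recorded distance of the farthest point in round [k + 1] is
   min_{1 <= j' <= k} d(p_{k+1}, p_{j'}). *)
Definition processor (k : nat) (tie : nat -> X -> X -> bool) (p1 : X)
    (Xi : seq X) : delay (seq X * seq X) :=
  let* D := mapM (fun x => let* dx := op (d x p1) in Now (x, dx)) Xi in
  let* k1 := op k.-1 in
  let* sel := select_farthest tie (p1, 0) k1 2 D in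
  let: (ps, D) := sel in
  let: Pi := p1 :: ps in
  let* last := farthest tie k.+1 (p1, 0) D in
  let* r := op (last.2 / 2) in
  let* rad := op (2 * r) in
  let* tables := mapM (fun p => representatives p rad Xi) Pi in
  let* lists := mapM list_of_table tables in
  let* Li := flattenM lists in
  Now (Pi, Li).

(* Greedy scan; the first point is added since P is still empty. *)
Definition scattered (rad : R) (l : seq X) : delay (seq X) :=
  foreach (fun P q =>
      let* far := foreach (fun (far : bool) p =>
          let* dpq := op (d p q) in
          let* gt := op (rad < dpq) in
          Now (far && gt))
        true P in
      Now (if far then q :: P else P))
    [::] l.

(* Node 0 is the source, node 1 the sink, node [2 + a] stands for the a-th set,
   node [2 + #sets + j] for group [j].  [caps] is the array of capacities.
   Besides the network, returns for each arc from a set to a group [j] its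
   number and the point of group [j] in the set.  These arcs get capacity 1:
   the flow through a set node is at most 1 anyway. *)
Definition build_network (caps : seq nat) (Ns : seq (seq (option X)))
    : delay (network * seq (nat * X)) :=
  let* c := lengthM Ns in
  let* nodes := op (c + m + 2)%N in
  let* arcs := op (c + c * m + m)%N in
  let* N := empty_network nodes arcs in
  let* Ne := for_upto c (fun (st : network * nat) a =>
      let* u := op (2 + a)%N in
      add_arc st.1 st.2 0 u 1)
    (N, 0%N) in
  let* st := foreach (fun (st : network * nat * seq (nat * X) * nat) T =>
      let: (Ne, mids, a) := st in
      let* u := op (2 + a)%N in
      let* st' := for_upto m (fun (st : network * nat * seq (nat * X)) j =>
          let: (N, e, mids) := st in
          let* o := array_get None T j in
          if o is Some x then
            let* v := op (2 + c + j)%N in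
            let* Ne := add_arc N e u v 1 in
            Now (Ne, (e, x) :: mids)
          else Now st)
        (Ne, mids) in
      let* a' := op a.+1 in
      Now (st', a'))
    (Ne, [::], 0%N) Ns in
  let: (Ne, mids, _) := st in
  let* Ne := for_upto m (fun (st : network * nat) j =>
      let* u := op (2 + c + j)%N in
      let* kj := array_get 0%N caps j in
      add_arc st.1 st.2 u 1 kj)
    Ne in
  Now (Ne.1, mids).

Definition selected_points (N : network) (mids : seq (nat * X))
    : delay (seq X) :=
  foreach (fun S (ex : nat * X) =>
      let: (e, x) := ex in
      let* e' := reverse_arc e in
      let* flow := array_get 0%N (residual N) e' in
      let* used := op (0 < flow)%N in
      Now (if used then x :: S else S))
    [::] mids.

Definition coordinator (caps : seq nat) (tau : R)
    (messages : seq (seq X * seq X)) : delay (seq X) :=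
  let* Ps := mapM (fun PL : seq X * seq X => Now PL.1) messages in
  let* Ls := mapM (fun PL : seq X * seq X => Now PL.2) messages in
  let* X' := flattenM Ps in
  let* L := flattenM Ls in
  let* tau10 := op (10 * tau) in
  let* tau5 := op (5 * tau) in
  let* P := scattered tau10 X' in
  let* Ns := mapM (fun q => representatives q tau5 L) P in
  let* Nm := build_network caps Ns in
  let: (N, mids) := Nm in
  let* N := ford_fulkerson N 0 1 in
  selected_points N mids.

End Algorithm.

Section FairCenter.
Context (R : realType) (X : finType) (d : X -> X -> R).
Context (m : nat) (g : X -> 'I_m) (kc : 'I_m -> nat).

Definition is_metric : Prop :=
  [/\ forall x y, 0 <= d x y,
      forall x y, d x y = 0 <-> x = y,
      forall x y, d x y = d y x &
      forall x y z, d x z <= d x y + d y z].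

(* With the convention that a minimum over the empty set is +oo, an empty set
   of centers never attains the optimum of a nonempty space. *)
Definition clustering_cost (A B : {set X}) : \bar R :=
  \big[Order.max/-oo%E]_(b in B) \big[Order.min/+oo%E]_(a in A) (d a b)%:E.

Definition feasible (S : {set X}) : bool :=
  [forall j, #|[set x in S | g x == j]| <= kc j]%N.

Definition OPT : \bar R :=
  \big[Order.min/+oo%E]_(S : {set X} | feasible S) clustering_cost S [set: X].

End FairCenter.

(* An input of the distributed algorithm together with the arbitrary choices
   made in its execution: the order in which each [X_i] is scanned, the first
   point of each processor, and the way ties in the argmax are broken. *)
Record execution (R : realType) := Execution {
  points : finType;
  dist : points -> points -> R;
  dist_metric : is_metric dist;
  groups : nat;
  group : points -> 'I_groups;
  capacity : 'I_groups -> nat;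
  threshold : R;
  threshold_ge_OPT : (OPT dist group capacity <= threshold%:E)%E;
  processors : nat;
  processors_gt0 : (0 < processors)%N;
  part : 'I_processors -> seq points;
  part_split : perm_eq (flatten [seq part i | i <- enum 'I_processors])
                       (enum points);
  part_equal : forall i, (size (part i) * processors = #|points|)%N;
  part_large : forall i, (\sum_j capacity j + 1 <= size (part i))%N;
  first_point : 'I_processors -> points;
  first_point_in : forall i, first_point i \in part i;
  tie_break : 'I_processors -> nat -> points -> points -> bool
}.

Definition total_capacity (R : realType) (E : execution R) : nat :=
  \sum_(j < groups E) capacity j.

Definition processor_program (R : realType) (E : execution R)
    (i : 'I_(processors E)) : delay (seq (points E) * seq (points E)) :=
  processor (@dist R E) (groups E) (fun x => val (group x))
    (total_capacity E) (tie_break i) (first_point i) (part i).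

Definition coordinator_program (R : realType) (E : execution R)
    (messages : 'I_(processors E) -> seq (points E) * seq (points E))
    : delay (seq (points E)) :=
  coordinator (@dist R E) (groups E) (fun x => val (group x))
    [seq capacity j | j <- enum 'I_(groups E)] (threshold E)
    [seq messages i | i <- enum 'I_(processors E)].

(* The processors run in parallel, then the coordinator on their messages. *)
Definition running_time (R : realType) (E : execution R) (T : nat) : Prop :=
  exists messages (t : 'I_(processors E) -> nat) S tc,
    [/\ forall i, takes (processor_program i) (messages i) (t i),
        takes (coordinator_program messages) S tc &
        T = (\max_i t i + tc)%N].

(* Main.v *)
(** Running times are bounded in a total-correctness calculus. Everything except
  the search and the augmentations of Ford-Fulkerson is a bounded loop, and the
  remaining factors are accounted for as follows.
  - Points pairwise more than [2 tau] apart have distinct centers in a feasible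
    solution of cost at most [tau], so the scan of the coordinator keeps at most
    [k] points (the same fact forces [k > 0]).
  - A search pushes every node at most once, so it takes time linear in the
    size [O(mk)] of the network, and the parents it records point backwards in
    the order of discovery, so tracing them terminates within the number of
    nodes.
  - The recorded path leaves the source once and never returns to it, so each
    augmentation decreases the total residual capacity of the arcs leaving the
    source, which is initially at most [k].
  When [l] is of the order of [w = sqrt(n / (m k))], both terms of the bound are
  of the order of [m k^2 w], since [n = m k w^2]. *)

Require Import Defs.
From HB Require Import structures.
From mathcomp Require Import all_boot all_order all_algebra.
From mathcomp Require Import reals constructive_ereal exp.
From mathcomp Require boolp.
From mathcomp Require Import zify ring lra.

Set Implicit Arguments.
Unset Strict Implicit.
Unset Printing Implicit Defensive.

Import Order.TTheory GRing.Theory Num.Theory.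

(** * Total correctness of timed programs *)

Definition ensures (A : Type) (p : delay A) (Q : A -> nat -> Prop) : Prop :=
  exists a t, takes p a t /\ Q a t.

Section Ensures.
Context (A : Type).
Implicit Types (p : delay A) (Q : A -> nat -> Prop).

Lemma ensures_now a Q : Q a 0 -> ensures (Now a) Q.
Proof. by move=> Qa; exists a, 0; split=> //; constructor. Qed.

Lemma ensures_later p Q :
  ensures p (fun a t => Q a t.+1) -> ensures (Later p) Q.
Proof. by move=> [a [t [pa Qa]]]; exists a, t.+1; split=> //; constructor. Qed.

Lemma ensures_op a Q : Q a 1 -> ensures (op a) Q.
Proof. by move=> Qa; apply: ensures_later; apply: ensures_now. Qed.

Lemma ensures_weaken p Q Q' :
  ensures p Q -> (forall a t, Q a t -> Q' a t) -> ensures p Q'.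
Proof. by move=> [a [t [pa Qa]]] sub; exists a, t; split=> //; apply: sub. Qed.

Lemma delay_unfold p :
  p = match p with Now a => Now a | Later q => Later q end.
Proof. by case: p. Qed.

End Ensures.

Section EnsuresBind.
Context (A B : Type).

Lemma bind_now (a : A) (f : A -> delay B) : bind (Now a) f = f a.
Proof. by rewrite [LHS]delay_unfold /=; case: (f a). Qed.

Lemma bind_later (p : delay A) (f : A -> delay B) :
  bind (Later p) f = Later (bind p f).
Proof. by rewrite [LHS]delay_unfold. Qed.

Lemma takes_bind (p : delay A) (f : A -> delay B) a b t t' :
  takes p a t -> takes (f a) b t' -> takes (bind p f) b (t + t').
Proof.
elim=> [a0|q a0 s _ IH] fb; first by rewrite bind_now.
by rewrite bind_later addSn; constructor; apply: IH.
Qed.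

Lemma ensures_bind (p : delay A) (f : A -> delay B) P Q :
  ensures p P ->
  (forall a t, P a t -> ensures (f a) (fun b t' => Q b (t + t'))) ->
  ensures (bind p f) Q.
Proof.
move=> [a [t [pa Pa]]] /(_ _ _ Pa) [b [t' [fb Qb]]].
by exists b, (t + t'); split=> //; apply: takes_bind fb.
Qed.

Lemma ensures_bind_op (a : A) (f : A -> delay B) Q :
  ensures (f a) (fun b t => Q b t.+1) -> ensures (bind (op a) f) Q.
Proof.
move=> fa.
apply: ensures_bind (ensures_op (Q := fun a' t => a' = a /\ t = 1) _) _ => //.
by move=> _ _ [-> ->].
Qed.

End EnsuresBind.

(* The match is syntactic: up to conversion, [ensures_bind_op] would also enter
   any subprogram that starts with a primitive operation. *)
Ltac run_ops := repeat (
  lazymatch goal with |- ensures (bind ?p _) _ =>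
    lazymatch p with
    | op _ => idtac
    | array_get _ _ _ => idtac
    | array_set _ _ _ _ => idtac
    | reverse_arc _ => idtac
    end
  end; apply: ensures_bind_op; cbv beta).

Section EnsuresForeach.
Context (A S : Type).

Lemma ensures_foreach (body : S -> A -> delay S) c
    (I : seq A -> S -> Prop) s l :
  (forall x l' s', I (x :: l') s' ->
     ensures (body s' x) (fun s2 t => I l' s2 /\ t <= c)) ->
  I l s ->
  ensures (foreach body s l) (fun s' t => I [::] s' /\ t <= c.+1 * size l + 1).
Proof.
move=> Istep; elim: l s => [|x l IH] s Is /=; apply: ensures_later.
  by apply: ensures_now; rewrite muln0.
apply: ensures_bind (Istep _ _ _ Is) _ => s' t [Is' le_t].
by apply: ensures_weaken (IH _ Is') _ => s2 t' [Is2 le_t']; split=> //; lia.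
Qed.

Lemma ensures_foreach_foldl (body : S -> A -> delay S) c (f : S -> A -> S) s l :
  (forall s' x, ensures (body s' x) (fun s2 t => s2 = f s' x /\ t <= c)) ->
  ensures (foreach body s l) (fun s' t =>
    s' = foldl f s l /\ t <= c.+1 * size l + 1).
Proof.
move=> bodyE.
apply: (ensures_foreach (I := fun l' s' => foldl f s' l' = foldl f s l)) => //.
by move=> x l' s' /= <-; apply: ensures_weaken (bodyE s' x) _ => _ t [-> le_t].
Qed.

End EnsuresForeach.

Lemma ensures_for_upto (S : Type) n (body : S -> nat -> delay S) c
    (I : nat -> S -> Prop) s :
  (forall i s', i < n -> I i s' ->
     ensures (body s' i) (fun s2 t => I i.+1 s2 /\ t <= c)) ->
  I 0 s ->
  ensures (for_upto n body s) (fun s' t => I n s' /\ t <= c.+1 * n + 1).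
Proof.
move=> Istep I0; rewrite /for_upto.
apply: ensures_weaken (ensures_foreach (c := c) (I := fun l s' =>
  exists i, [/\ l = iota i (size l), i + size l = n & I i s']) _ _) _.
- move=> x l s' [i [/= [-> El] En Is']].
  apply: ensures_weaken (Istep _ _ _ Is') _; first by lia.
  by move=> s2 t [Is2 le_t]; split=> //; exists i.+1; split=> //; lia.
- by exists 0; rewrite size_iota.
move=> s' t [[i [_ /= En Is']]]; rewrite size_iota.
by move: Is'; rewrite -En addn0.
Qed.

Lemma ensures_mapM (A B : Type) (f : A -> delay B) (P : pred A) (Q : pred B)
    c l :
  (forall x, P x -> ensures (f x) (fun y t => Q y /\ t <= c)) -> all P l ->
  ensures (mapM f l) (fun ys t =>
    [/\ size ys = size l, all Q ys & t <= c.+1 * size l + 1]).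
Proof.
move=> fP; elim: l => [|x l IH] /= => [_|/andP[Px Pl]]; apply: ensures_later.
  by apply: ensures_now; rewrite muln0.
apply: ensures_bind (fP _ Px) _ => y t [Qy le_t].
apply: ensures_bind (IH Pl) _ => ys t' [sz_ys Qys le_t'].
by apply: ensures_now; rewrite /= sz_ys Qy; split=> //; lia.
Qed.

Section EnsuresLoop.
Context (A S : Type) (body : S -> delay (S + A)).

Lemma takes_loop_from p r a t t' :
  takes p r t -> takes (loop_from body (Now r)) a t' ->
  takes (loop_from body p) a (t + t').
Proof.
elim=> [//|q r' t0 _ IH] ra.
by rewrite [loop_from _ _]delay_unfold /= addSn; constructor; apply: IH.
Qed.

(* [I s n] says that at most [n] more steps are needed from the state [s]. *)
Lemma ensures_loop (I : S -> nat -> Prop) (Q : A -> Prop) s n :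
  (forall s' n', I s' n' -> ensures (body s') (fun r t =>
     match r with
     | inl s2 => exists2 n2, I s2 n2 & t + n2 < n'
     | inr a => Q a /\ t <= n'
     end)) ->
  I s n -> ensures (loop body s) (fun a t => Q a /\ t <= n.+1).
Proof.
move=> Istep Is; apply: ensures_later.
elim/ltn_ind: n s Is => n IH s Is.
have [[s2|a] [t [sr]]] := Istep _ _ Is.
  move=> [n2 Is2 lt_n].
  have [|a [t' [s2a [Qa le_t']]]] := IH n2 _ s2 Is2; first by lia.
  exists a, (t + t'.+1); split; last by split=> //; lia.
  apply: takes_loop_from sr _.
  by rewrite [loop_from _ _]delay_unfold; constructor.
move=> [Qa le_t]; exists a, (t + 0); split; last by rewrite addn0.
apply: takes_loop_from sr _.
by rewrite [loop_from _ _]delay_unfold; constructor.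
Qed.

End EnsuresLoop.

Section EnsuresArrays.
Context (A : Type).

Lemma ensures_array_new n (x : A) :
  ensures (array_new n x) (fun a t => a = nseq n x /\ t = n.+1).
Proof.
elim: n => [|n IH]; apply: ensures_later; first by apply: ensures_now.
by apply: ensures_bind IH _ => _ _ [-> ->]; apply: ensures_now; rewrite addn0.
Qed.

Lemma ensures_lengthM (l : seq A) :
  ensures (lengthM l) (fun c t => c = size l /\ t <= 2 * size l + 1).
Proof.
apply: ensures_weaken (ensures_foreach (c := 1)
  (I := fun l' c => c + size l' = size l) _ _) _ => //.
- by move=> x l' c /= Ec; apply: ensures_op; split=> //; lia.
- by move=> c t [/= Ec le_t]; split=> //; lia.
Qed.

Lemma ensures_catM (l1 l2 : seq A) :
  ensures (catM l1 l2) (fun l t => l = l1 ++ l2 /\ t = (size l1).+1).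
Proof.
elim: l1 => [|x l1 IH]; apply: ensures_later; first by apply: ensures_now.
by apply: ensures_bind IH _ => _ _ [-> ->]; apply: ensures_now; rewrite addn0.
Qed.

Lemma ensures_flattenM (ls : seq (seq A)) :
  ensures (flattenM ls) (fun l t =>
    l = flatten ls /\ t = size (flatten ls) + 2 * size ls + 1).
Proof.
elim: ls => [|l ls IH]; apply: ensures_later; first by apply: ensures_now.
apply: ensures_bind IH _ => _ _ [-> ->].
apply: ensures_weaken (ensures_catM _ _) _ => _ _ [-> ->].
by rewrite /= size_cat; split=> //; lia.
Qed.

Lemma size_flatten_le b (ls : seq (seq A)) :
  all (fun l => size l <= b) ls -> size (flatten ls) <= size ls * b.
Proof.
elim: ls => [//|l ls IH] /= /andP[le_b /IH le_flatten].
by rewrite size_cat mulSn leq_add.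
Qed.

Lemma size_set_nth_lt (x0 : A) s i x :
  i < size s -> size (set_nth x0 s i x) = size s.
Proof. by rewrite size_set_nth => /maxn_idPr. Qed.

Lemma nth_set_nthE (x0 : A) s i x j :
  nth x0 (set_nth x0 s i x) j = if j == i then x else nth x0 s j.
Proof. by rewrite nth_set_nth. Qed.

End EnsuresArrays.

(** * Residual networks *)

Definition rev_arc (e : nat) : nat := if odd e then e.-1 else e.+1.

Lemma rev_arcK : involutive rev_arc.
Proof. by rewrite /rev_arc; case=> [|e] //=; case E: (odd e); rewrite /= E. Qed.

Lemma rev_arc_neq e : (rev_arc e == e) = false.
Proof. by rewrite /rev_arc; case: ifP => odd_e; apply/eqP; lia. Qed.

Definition head_of (N : network) e := nth 0 (arc_head N) e.
Definition tail_of (N : network) e := head_of N (rev_arc e).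
Definition cap_of (N : network) e := nth 0 (residual N) e.
Definition arcs_from (N : network) u := nth [::] (adjacency N) u.

Lemma tail_of_rev N e : tail_of N (rev_arc e) = head_of N e.
Proof. by rewrite /tail_of rev_arcK. Qed.

(* The arc numbers in use are those below [M]. *)
Definition well_formed (N : network) (M : nat) : Prop :=
  [/\ ~~ odd M,
      forall u e : nat, e \in arcs_from N u ->
        [/\ e < M, tail_of N e = u & head_of N e < num_nodes N] &
      \sum_(u < num_nodes N) size (arcs_from N u) <= M].

Definition out_capacity (N : network) (s M : nat) : nat :=
  \sum_(e < M | tail_of N e == s) cap_of N e.

Definition residual_arc (N : network) (M u v e : nat) : Prop :=
  [/\ e < M, 0 < cap_of N e, tail_of N e = u & head_of N e = v].

Lemma sum_eq_le1 n (i : nat) : \sum_(w < n) (w == i :> nat) <= 1.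
Proof.
rewrite -big_mkcond /= (eq_bigr (fun=> 1)) // (big_ord1_eq _ (fun=> 1)).
by case: ifP.
Qed.

Section AddArc.
Context (N : network) (e u v c : nat).

Definition with_arc : network :=
  let adj := set_nth [::] (adjacency N) u (e :: arcs_from N u) in
  Network (num_nodes N)
    (set_nth 0 (set_nth 0 (arc_head N) e v) (rev_arc e) u)
    (set_nth 0 (set_nth 0 (residual N) e c) (rev_arc e) 0)
    (set_nth [::] adj v (rev_arc e :: nth [::] adj v)).

Lemma ensures_add_arc :
  ensures (add_arc N e u v c) (fun Ne t => Ne = (with_arc, e.+2) /\ t = 10).
Proof. by rewrite /add_arc; run_ops; apply: ensures_now. Qed.

Lemma head_with_arc x : head_of with_arc x =
  if x == rev_arc e then u else if x == e then v else head_of N x.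
Proof. by rewrite /head_of /= !nth_set_nthE. Qed.

Lemma tail_with_arc x : tail_of with_arc x =
  if x == e then u else if x == rev_arc e then v else tail_of N x.
Proof.
by rewrite /tail_of head_with_arc (inj_eq (inv_inj rev_arcK)) (inv_eq rev_arcK).
Qed.

Lemma cap_with_arc x : cap_of with_arc x =
  if x == rev_arc e then 0 else if x == e then c else cap_of N x.
Proof. by rewrite /cap_of /= !nth_set_nthE. Qed.

Lemma arcs_from_with_arc w : arcs_from with_arc w =
  nseq (w == v) (rev_arc e) ++ nseq (w == u) e ++ arcs_from N w.
Proof.
rewrite /arcs_from /= !nth_set_nthE.
case: (w =P v) => [->|_] /=; first by case: (v =P u) => [->|].
by case: (w =P u) => [->|].
Qed.

Hypotheses (even_e : ~~ odd e) (wf : well_formed N e).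

Lemma well_formed_with_arc : u < num_nodes N -> v < num_nodes N ->
  well_formed with_arc e.+2.
Proof.
move: wf => [_ wf_arc wf_size] uV vV; split; first by rewrite /= negbK.
- move=> w x; rewrite arcs_from_with_arc !mem_cat !mem_nseq.
  rewrite tail_with_arc head_with_arc /rev_arc (negbTE even_e).
  case/or3P=> [/andP[]|/andP[]|/wf_arc[xe <- hx]].
  + by case: (w =P v) => // -> _ /eqP->; rewrite eqxx gtn_eqF.
  + by case: (w =P u) => // -> _ /eqP->; rewrite eqxx ltn_eqF.
  + have -> : (x == e) = false by apply: ltn_eqF.
    have -> : (x == e.+1) = false by apply: ltn_eqF; lia.
    by split=> //; lia.
- rewrite /=; under eq_bigr do rewrite arcs_from_with_arc !size_cat !size_nseq.
  rewrite !big_split /=.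
  exact: leq_add (sum_eq_le1 _ _) (leq_add (sum_eq_le1 _ _) wf_size).
Qed.

Lemma out_capacity_with_arc s :
  out_capacity with_arc s e.+2 = out_capacity N s e + (u == s) * c.
Proof.
have rev_e : rev_arc e = e.+1 by rewrite /rev_arc (negbTE even_e).
rewrite /out_capacity big_mkcond !big_ord_recr /= -big_mkcond /=.
rewrite tail_with_arc !cap_with_arc rev_e !eqxx if_same addn0.
rewrite (ltn_eqF (ltnSn e)).
congr (_ + _); last by case: (u == s); rewrite ?mul1n.
have old_arc (x : 'I_e) : (x == e :> nat) = false /\ (x == e.+1 :> nat) = false.
  by split; apply/eqP; have := ltn_ord x; lia.
apply: eq_big => [x|x _].
  by rewrite tail_with_arc rev_e !(old_arc x).1 !(old_arc x).2.
by rewrite cap_with_arc rev_e !(old_arc x).1 !(old_arc x).2.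
Qed.

End AddArc.

Lemma ensures_empty_network nodes arcs s :
  ensures (empty_network nodes arcs) (fun N t =>
    [/\ t = 4 * arcs + nodes + 4, num_nodes N = nodes, well_formed N 0 &
        out_capacity N s 0 = 0]).
Proof.
rewrite /empty_network; run_ops.
do 3![apply: ensures_bind (ensures_array_new _ _) _ => _ _ [-> ->]].
apply: ensures_now; split=> //; first by lia.
- split=> //= [u e|]; first by rewrite /arcs_from /= nth_nseq if_same.
  by rewrite big1 // => u _; rewrite /arcs_from /= nth_nseq if_same.
- by rewrite /out_capacity big_ord0.
Qed.

(** * The Ford-Fulkerson algorithm *)

Section Search.
Context (N : network) (M s : nat).

(* The visited nodes in reverse order of discovery. *)
Inductive discovered (parent : seq nat) : seq nat -> Prop :=
  | discovered_source : discovered parent [:: s]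
  | discovered_arc (u v : nat) (l : seq nat) :
      discovered parent l -> v \notin l -> u \in l ->
      residual_arc N M u v (nth 0 parent v) -> discovered parent (v :: l).

Lemma discovered_uniq parent l : discovered parent l -> uniq l.
Proof. by elim=> [//|u v l' _ uniq_l' vl' _ _] /=; rewrite vl'. Qed.

Lemma discovered_set_parent parent v e l :
  v \notin l -> discovered parent l -> discovered (set_nth 0 parent v e) l.
Proof.
move=> + disc; elim: disc => [|u w l' _ IH wl' ul' arc_w]; first by constructor.
rewrite inE negb_or => /andP[vw vl'].
apply: (discovered_arc (u := u)) => //; first exact: IH.
by rewrite nth_set_nthE eq_sym (negbTE vw).
Qed.

Lemma discovered_suffix parent l (v : nat) : discovered parent l -> v \in l ->
  exists2 l' : seq nat, discovered parent (v :: l') & size l' < size l.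
Proof.
elim=> [|u w l' disc IH wl' ul' arc_w].
  by rewrite inE => /eqP->; exists [::] => //; constructor.
rewrite inE => /orP[/eqP->|/IH[l2 disc2 lt_l']].
  by exists l' => //; apply: discovered_arc arc_w.
by exists l2 => //; apply: leqW.
Qed.

(* [scan_arc] and [search_step] are the bodies of the two loops of [search]. *)
Definition search_state : Type := (seq nat * seq bool * seq nat)%type.

Definition scan_arc (st : search_state) (e : nat) : delay search_state :=
  let: (stack, seen, parent) := st in
  let* r := array_get 0 (residual N) e in
  let* v := array_get 0 (arc_head N) e in
  let* seen_v := array_get false seen v in
  let* new := op ((0 < r) && ~~ seen_v) in
  if new then
    let* seen := array_set false seen v true in
    let* parent := array_set 0 parent v e in
    Now (v :: stack, seen, parent)
  else Now st.

Definition search_step (st : search_state)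
    : delay (search_state + seq bool * seq nat) :=
  let: (stack, seen, parent) := st in
  if stack is u :: stack' then
    let* es := array_get [::] (adjacency N) u in
    let* st' := foreach scan_arc (stack', seen, parent) es in
    Now (inl st')
  else Now (inr (seen, parent)).

Definition search_inv (disc : seq nat) (st : search_state) : Prop :=
  let: (stack, seen, parent) := st in
  [/\ discovered parent disc, forall v, nth false seen v = (v \in disc),
      {subset stack <= disc} & all (fun v => v < num_nodes N) disc].

Lemma search_inv_pop disc u stack seen parent :
  search_inv disc (u :: stack, seen, parent) ->
  u \in disc /\ search_inv disc (stack, seen, parent).
Proof.
move=> [disc_l seenE sub lt_V]; split; first by apply: sub; rewrite inE eqxx.
by split=> // v v_stack; apply: sub; rewrite inE v_stack orbT.
Qed.

Lemma search_inv_push disc u v e stack seen parent :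
  search_inv disc (stack, seen, parent) ->
  u \in disc -> v \notin disc -> v < num_nodes N -> residual_arc N M u v e ->
  search_inv (v :: disc)
    (v :: stack, set_nth false seen v true, set_nth 0 parent v e).
Proof.
move=> [disc_l seenE sub lt_V] ud vd vV arc_e; split.
- apply: (discovered_arc (u := u)) => //; first exact: discovered_set_parent.
  by rewrite nth_set_nthE eqxx.
- by move=> w; rewrite nth_set_nthE inE seenE; case: eqP.
- by move=> w; rewrite !inE => /orP[->//|/sub->]; apply: orbT.
- by rewrite /= vV.
Qed.

(* The time taken to pop [u] and to scan its arcs. *)
Definition visit_time (u : nat) : nat := 3 + 7 * size (arcs_from N u).

Definition search_potential (st : search_state) : nat :=
  \sum_(v < num_nodes N | ~~ nth false st.1.2 v) visit_time v +
  \sum_(v <- st.1.1) visit_time v.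

Lemma search_potential_pop u stack seen parent :
  search_potential (u :: stack, seen, parent) =
  visit_time u + search_potential (stack, seen, parent).
Proof. by rewrite /search_potential big_cons addnCA. Qed.

Lemma search_potential_push v stack seen parent parent' :
  v < num_nodes N -> ~~ nth false seen v ->
  search_potential (v :: stack, set_nth false seen v true, parent') =
  search_potential (stack, seen, parent).
Proof.
move=> vV unseen; rewrite /search_potential big_cons addnCA addnA.
congr (_ + _).
rewrite [RHS](bigD1 (Ordinal vV)) //=; congr (_ + _).
apply: eq_bigl => w; rewrite nth_set_nthE -val_eqE /=.
by case: eqP; rewrite ?andbT ?andbF.
Qed.

Hypothesis wf : well_formed N M.

Lemma ensures_scan_arc disc (u e : nat) st :
  search_inv disc st -> u \in disc -> e \in arcs_from N u ->
  ensures (scan_arc st e) (fun st' t => t <= 6 /\ exists disc',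
    [/\ search_inv disc' st', u \in disc' &
        search_potential st' = search_potential st]).
Proof.
case: st => [[stack seen] parent] inv ud.
case: wf => _ wf_arc _ /wf_arc[eM te hV].
rewrite /scan_arc; run_ops; case: ifP => [/andP[cap_e unseen]|_]; last first.
  by apply: ensures_now; split=> //; exists disc.
run_ops; apply: ensures_now; split=> //; exists (head_of N e :: disc).
split; last exact: search_potential_push.
- apply: (search_inv_push inv ud _ hV) => //.
  by case: inv => _ seenE _ _; rewrite -seenE.
- by rewrite inE ud orbT.
Qed.

Lemma ensures_search_step disc u stack seen parent :
  let st := (u :: stack, seen, parent) in
  search_inv disc st ->
  ensures (search_step st) (fun r t => exists2 st', r = inl st' &
    (exists disc', search_inv disc' st') /\
    t + search_potential st' < search_potential st).
Proof.
move=> st /search_inv_pop[ud inv]; rewrite /search_step /st; run_ops.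
apply: ensures_bind (ensures_foreach (c := 6) (I := fun (es : seq nat) st' =>
  {subset es <= arcs_from N u} /\ exists disc',
     [/\ search_inv disc' st', u \in disc' &
      search_potential st' = search_potential (stack, seen, parent)]) _ _) _.
- move=> e es st' [sub [disc' [inv' ud' pot']]].
  apply: ensures_weaken (ensures_scan_arc inv' ud' _) _.
    by apply: sub; rewrite inE eqxx.
  move=> st2 t [le_t [disc2 [inv2 ud2 pot2]]]; split=> //; split.
    by move=> e' e'es; apply: sub; rewrite inE e'es orbT.
  by exists disc2; rewrite pot2.
- by split=> //; exists disc.
move=> st' t [[_ [disc' [inv' _ pot']]] le_t]; apply: ensures_now.
exists st' => //; split; first by exists disc'.
by rewrite search_potential_pop pot' /visit_time /arcs_from; lia.
Qed.

Lemma sum_visit_time_le :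
  \sum_(v < num_nodes N) visit_time v <= 3 * num_nodes N + 7 * M.
Proof.
case: wf => _ _ wf_size.
rewrite big_split /= sum_nat_const card_ord -big_distrr /=.
by rewrite mulnC leq_add2l leq_mul2l.
Qed.

Lemma ensures_search : s < num_nodes N ->
  ensures (search N s) (fun sp t => t <= 5 * num_nodes N + 7 * M + 4 /\
    exists disc : seq nat, [/\ discovered sp.2 disc,
      forall v, nth false sp.1 v = (v \in disc) & size disc <= num_nodes N]).
Proof.
move=> sV; rewrite /search.
do 2![apply: ensures_bind (ensures_array_new _ _) _ => _ _ [-> ->]]; run_ops.
set parent := nseq _ 0.
apply: ensures_weaken (ensures_loop (body := search_step)
  (n := 3 * num_nodes N + 7 * M) (I := fun st n =>
     (exists disc, search_inv disc st) /\ search_potential st <= n)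
  (Q := fun sp => exists disc, search_inv disc ([::], sp.1, sp.2)) _ _) _.
- move=> [[[|u stack] seen] parent'] n [[disc inv] le_n].
    by apply: ensures_now; split=> //; exists disc.
  apply: ensures_weaken (ensures_search_step inv) _ => r t.
  move=> [st' -> [inv' lt_pot]].
  by exists (search_potential st') => //; apply: leq_trans lt_pot le_n.
- split.
    exists [:: s]; split=> //; [by constructor| |by rewrite /= sV].
    by move=> v; rewrite nth_set_nthE nth_nseq if_same inE; case: eqP.
  rewrite (search_potential_push _ parent) // ?nth_nseq ?if_same //.
  apply: leq_trans sum_visit_time_le; rewrite /search_potential big_nil addn0.
  by apply/eq_leq/eq_bigl => v; rewrite nth_nseq if_same.
move=> sp t [[disc [disc_l seenE _ lt_V]] le_t]; split; first by lia.
exists disc; split=> //; rewrite -(size_iota 0 (num_nodes N)).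
apply: uniq_leq_size (discovered_uniq disc_l) _ => v /(allP lt_V).
by rewrite mem_iota.
Qed.

End Search.

Section Augmentation.
Context (N : network) (M s t : nat).

Fixpoint residual_walk (u : nat) (path : seq nat) (v : nat) : Prop :=
  if path is e :: path' then
    residual_arc N M u (head_of N e) e /\ residual_walk (head_of N e) path' v
  else u = v.

Definition augmenting (path : seq nat) : Prop :=
  residual_walk s path t /\ all (fun e => head_of N e != s) path.

Lemma residual_walk_caps u path v :
  residual_walk u path v -> all (fun e => 0 < cap_of N e) path.
Proof. by elim: path u => [//|e path IH] u /= [[_ -> _ _] /IH]. Qed.

Lemma residual_walk_tail_neq u path v : residual_walk u path v -> u != s ->
  all (fun e => head_of N e != s) path -> all (fun e => tail_of N e != s) path.
Proof.
elim: path u => [//|e path IH] u /= [[_ _ -> _] walk] -> /andP[he heads].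
exact: IH walk he heads.
Qed.

Lemma ensures_trace_path parent disc :
  discovered N M s parent disc -> t \in disc ->
  ensures (trace_path N parent s t) (fun path time =>
    (size path <= size disc /\ augmenting path) /\ time <= 5 * size disc + 2).
Proof.
move=> disc_l td; rewrite /trace_path.
have [l0 disc0 lt_l0] := discovered_suffix disc_l td.
apply: ensures_weaken (ensures_loop (n := 5 * size l0 + 1)
  (I := fun st n => exists l,
     [/\ discovered N M s parent (st.1 :: l), 5 * size l + 1 <= n,
         size st.2 + size l <= size disc, residual_walk st.1 st.2 t &
         all (fun e => head_of N e != s) st.2])
  (Q := fun path => size path <= size disc /\ augmenting path) _ _) _.
- move=> [v path] n [l /= [disc_v le_n le_size walk heads]].
  run_ops; case: eqP => [vs|/eqP vs].
    apply: ensures_now; rewrite vs in walk; split; last by lia.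
    by split; [lia|].
  run_ops; apply: ensures_now => /=; set e := nth 0 parent v.
  have [u [arc_e disc_l' ul]] : exists u,
      [/\ residual_arc N M u v e, discovered N M s parent l & u \in l].
    by inversion disc_v; subst; [rewrite eqxx in vs|exists u].
  have [_ _ te hv] := arc_e.
  have [l' disc_u lt_l'] := discovered_suffix disc_l' ul.
  exists (5 * size l' + 1); last by lia.
  exists l'; rewrite /= -/(rev_arc e) -/(head_of N _) -/(tail_of N e) te hv.
  by rewrite vs; split=> //; lia.
- by exists l0; split=> //; rewrite add0n ltnW.
- by move=> path time [spec le_time]; split=> //; lia.
Qed.

Definition min_residual (b : option nat) (e : nat) : option nat :=
  Some (if b is Some b' then minn b' (cap_of N e) else cap_of N e).

Definition bottleneck (path : seq nat) : nat :=
  odflt 0 (foldl min_residual None path).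

Definition push_flow (b : nat) (rs : seq nat) (e : nat) : seq nat :=
  let rs' := set_nth 0 rs e (nth 0 rs e - b) in
  set_nth 0 rs' (rev_arc e) (nth 0 rs' (rev_arc e) + b).

Definition augmented (path : seq nat) : network :=
  set_residual N (foldl (push_flow (bottleneck path)) (residual N) path).

Lemma ensures_augment path :
  ensures (augment N path) (fun N' time =>
    N' = augmented path /\ time <= 11 * size path + 2).
Proof.
rewrite /augment.
apply: ensures_bind
  (ensures_foreach_foldl (c := 2) (f := min_residual) _ _ _) _.
  by move=> b e; run_ops; apply: ensures_op.
move=> _ t1 [-> le_t1].
apply: ensures_bind
  (ensures_foreach_foldl (c := 7) (f := push_flow (bottleneck path)) _ _ _) _.
  by move=> rs e; run_ops; apply: ensures_op.
by move=> _ t2 [-> le_t2]; apply: ensures_now; split=> //; lia.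
Qed.

Lemma bottleneck_gt0 path :
  path != [::] -> all (fun e => 0 < cap_of N e) path -> 0 < bottleneck path.
Proof.
case: path => [//|e path] _ /=.
rewrite /bottleneck /= -[min_residual None e]/(Some (cap_of N e)).
elim: path (cap_of N e) => [|e' path IH] b /andP[b_gt0 //= /andP[cap_e' caps]].
by apply: IH; rewrite leq_min b_gt0 cap_e'.
Qed.

Lemma nth_push_flow b rs e a : nth 0 (push_flow b rs e) a =
  if a == rev_arc e then nth 0 rs a + b
  else if a == e then nth 0 rs a - b else nth 0 rs a.
Proof.
rewrite !nth_set_nthE rev_arc_neq.
by case: (a =P rev_arc e) => [->|_] //; case: (a =P e) => [->|].
Qed.

(* The reverse of an arc leaving [s] enters [s]. *)
Lemma out_arc_neq_rev a e : tail_of N a = s -> head_of N e != s ->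
  (a == rev_arc e) = false.
Proof.
by move=> ta he; apply: contra_neqF he => /eqP Ea; rewrite -ta Ea tail_of_rev.
Qed.

Lemma nth_foldl_push_flow b rs path a : tail_of N a = s ->
  all (fun e => head_of N e != s) path ->
  all (fun e => tail_of N e != s) path ->
  nth 0 (foldl (push_flow b) rs path) a = nth 0 rs a.
Proof.
move=> ta; elim: path rs => [//|e path IH] rs /=.
move=> /andP[he heads] /andP[te tails].
rewrite IH // nth_push_flow out_arc_neq_rev //.
by case: (a =P e) te => // <-; rewrite ta eqxx.
Qed.

Lemma out_capacity_augmented_lt path : t != s -> augmenting path ->
  out_capacity (augmented path) s M < out_capacity N s M.
Proof.
case: path => [|e path] ts [walk heads]; first by rewrite -walk eqxx in ts.
have b_gt0 : 0 < bottleneck (e :: path).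
  by apply: bottleneck_gt0 (residual_walk_caps walk).
case: walk heads => [[eM cap_e te _] walk] /= /andP[he heads].
have cap_augmented a : tail_of N a = s -> cap_of (augmented (e :: path)) a =
    if a == e then cap_of N a - bottleneck (e :: path) else cap_of N a.
  move=> ta; rewrite /cap_of /= nth_foldl_push_flow //.
    by rewrite nth_push_flow out_arc_neq_rev.
  exact: residual_walk_tail_neq walk he heads.
rewrite /out_capacity (bigD1 (Ordinal eM)) /=; last exact/eqP.
rewrite [ltnRHS](bigD1 (Ordinal eM)) /=; last exact/eqP.
rewrite -addSn leq_add //.
  by rewrite cap_augmented // eqxx; lia.
apply: leq_sum => a /andP[/eqP ta ae]; rewrite cap_augmented //.
by rewrite -val_eqE /= in ae; rewrite (negbTE ae).
Qed.

End Augmentation.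

Lemma ensures_ford_fulkerson N M s t c :
  well_formed N M -> s < num_nodes N -> t != s -> out_capacity N s M <= c ->
  ensures (ford_fulkerson N s t) (fun _ time =>
    time <= c.+1 * (21 * num_nodes N + 7 * M + 10) + 1).
Proof.
move=> wf sV ts le_c; rewrite /ford_fulkerson.
set round := 21 * num_nodes N + 7 * M + 10.
apply: ensures_weaken (ensures_loop (n := c.+1 * round) (I := fun N' n =>
  [/\ well_formed N' M, num_nodes N' = num_nodes N &
     (out_capacity N' s M).+1 * round <= n]) (Q := fun=> True) _ _) _.
- move=> N' n [wf' EV le_n].
  apply: ensures_bind (ensures_search wf' _) _; first by rewrite EV.
  move=> [seen parent] t1 [le_t1 [disc [disc_l seenE le_disc]]].
  rewrite EV in le_t1 le_disc; run_ops; case: ifP => /= [seen_t|_]; last first.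
    by apply: ensures_now; split=> //; rewrite mulSn /round in le_n; lia.
  rewrite seenE in seen_t.
  apply: ensures_bind (ensures_trace_path disc_l seen_t) _ => path t2.
  move=> [[le_path aug] le_t2].
  apply: ensures_bind (ensures_augment _ _) _ => _ t3 [-> le_t3].
  apply: ensures_now.
  exists ((out_capacity (augmented N' path) s M).+1 * round) => //.
  apply: leq_trans le_n; rewrite -addSn [leqRHS]mulSn.
  apply: leq_add; first by rewrite /round; lia.
  by rewrite leq_mul2r (out_capacity_augmented_lt ts) ?orbT.
- by split=> //; rewrite leq_mul2r ltnS le_c orbT.
- by move=> _ time [_]; rewrite addn1.
Qed.

(** * The network of the coordinator *)

Section BuildNetwork.
Context (X : Type) (m : nat).
Implicit Types (Ne : network * nat) (mids : seq (nat * X)).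

(* At most [b] arcs have been added, of total capacity at most [q] out of the
   source. *)
Definition building (V b q : nat) (Ne : network * nat) : Prop :=
  [/\ num_nodes Ne.1 = V, well_formed Ne.1 Ne.2, Ne.2 <= 2 * b &
      out_capacity Ne.1 0 Ne.2 <= q].

Lemma building_leq V b b' q Ne :
  b <= b' -> building V b q Ne -> building V b' q Ne.
Proof. by move=> le_b [EV wf le_e le_q]; split=> //; lia. Qed.

Lemma ensures_add_arc_building V b q Ne u v c :
  building V b q Ne -> u < V -> v < V ->
  ensures (add_arc Ne.1 Ne.2 u v c) (fun Ne' t =>
    building V b.+1 (q + (u == 0) * c) Ne' /\ t <= 10).
Proof.
move=> [<- wf le_e le_q] uV vV; have [even_e _ _] := wf.
apply: ensures_weaken (ensures_add_arc _ _ _ _ _) _ => _ _ [-> ->].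
split=> //; split=> //=; [exact: well_formed_with_arc|by lia|].
by rewrite out_capacity_with_arc // leq_add2r.
Qed.

(* The loops of [build_network]. *)
Definition add_source_arcs (c : nat) Ne : delay (network * nat) :=
  for_upto c (fun st a => let* u := op (2 + a) in add_arc st.1 st.2 0 u 1) Ne.

Definition add_set_arcs (c u : nat) (T : seq (option X)) Ne mids
    : delay (network * nat * seq (nat * X)) :=
  for_upto m (fun st j =>
    let: (N, e, mids) := st in
    let* o := array_get None T j in
    if o is Some x then
      let* v := op (2 + c + j) in
      let* Ne := add_arc N e u v 1 in
      Now (Ne, (e, x) :: mids)
    else Now st) (Ne, mids).

Definition add_all_set_arcs (c : nat) (Ns : seq (seq (option X))) Ne
    : delay (network * nat * seq (nat * X) * nat) :=
  foreach (fun st T =>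
    let: (Ne, mids, a) := st in
    let* u := op (2 + a) in
    let* st' := add_set_arcs c u T Ne mids in
    let* a' := op a.+1 in
    Now (st', a')) (Ne, [::], 0) Ns.

Definition add_group_arcs (c : nat) (caps : seq nat) Ne
    : delay (network * nat) :=
  for_upto m (fun st j =>
    let* u := op (2 + c + j) in
    let* kj := array_get 0 caps j in
    add_arc st.1 st.2 u 1 kj) Ne.

Lemma ensures_add_source_arcs V b q c Ne : c + 2 <= V -> building V b q Ne ->
  ensures (add_source_arcs c Ne) (fun Ne' t =>
    building V (b + c) (q + c) Ne' /\ t <= 12 * c + 1).
Proof.
move=> le_V bldg.
apply: (ensures_for_upto (c := 11) (I := fun i => building V (b + i) (q + i))).
  move=> a st lt_c bldg'; run_ops.
  apply: ensures_weaken (ensures_add_arc_building 1 bldg' _ _) _;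
    [by lia|by lia|].
  by rewrite !addnS addn0 => st' t [bldg2 le_t]; split=> //; lia.
by rewrite !addn0.
Qed.

Lemma ensures_add_set_arcs V b q c u T Ne mids :
  0 < u < V -> 2 + c + m <= V -> building V b q Ne ->
  ensures (add_set_arcs c u T Ne mids) (fun st t =>
    (building V (b + m) q st.1 /\ size st.2 <= size mids + m) /\
    t <= 13 * m + 1).
Proof.
move=> /andP[u_gt0 uV] le_V bldg.
apply: (ensures_for_upto (c := 12) (I := fun i st =>
  building V (b + i) q st.1 /\ size st.2 <= size mids + i)); last first.
  by rewrite !addn0.
move=> j [[N e] mids'] /= lt_m [bldg' le_mids']; run_ops.
case: (nth None T j) => [x|]; last first.
  apply: ensures_now; split=> //; split; last by rewrite /=; lia.
  by apply: building_leq bldg'; rewrite addnS.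
run_ops; apply: ensures_bind (ensures_add_arc_building 1 bldg' _ _) _;
  [by lia|by lia|].
move=> Ne' t []; rewrite gtn_eqF // addn0 => bldg2 le_t.
by apply: ensures_now; rewrite !addnS; split; [split|lia].
Qed.

Lemma ensures_add_all_set_arcs V b q c Ns Ne :
  size Ns = c -> 2 + c + m <= V -> building V b q Ne ->
  ensures (add_all_set_arcs c Ns Ne) (fun st t =>
    (building V (b + c * m) q st.1.1 /\ size st.1.2 <= c * m) /\
    t <= (13 * m + 5) * c + 1).
Proof.
move=> <- le_V bldg.
apply: ensures_weaken (ensures_foreach (c := 13 * m + 4) (I := fun l st =>
  [/\ st.2 + size l = size Ns, building V (b + st.2 * m) q st.1.1 &
      size st.1.2 <= st.2 * m]) _ _) _.
- move=> T l [[Ne' mids] a] /= [Ea bldg' le_mids]; run_ops.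
  apply: ensures_bind (ensures_add_set_arcs T mids _ _ bldg') _;
    [by lia|by lia|].
  move=> st t [[bldg2 le_mids2] le_t]; run_ops; apply: ensures_now => /=.
  by rewrite mulSnr addnA; split; [split=> //; lia|lia].
- by rewrite !mul0n addn0.
move=> [[Ne' mids] a] t [[/= Ea bldg' le_mids] le_t].
by rewrite addn0 in Ea; rewrite -Ea in le_t *; split=> //; lia.
Qed.

Lemma ensures_add_group_arcs V b q c caps Ne :
  2 + c + m <= V -> building V b q Ne ->
  ensures (add_group_arcs c caps Ne) (fun Ne' t =>
    building V (b + m) q Ne' /\ t <= 13 * m + 1).
Proof.
move=> le_V bldg.
apply: (ensures_for_upto (c := 12) (I := fun i => building V (b + i) q)).
  move=> j st lt_m bldg'; run_ops.
  apply: ensures_weaken (ensures_add_arc_building _ bldg' _ _) _;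
    [by lia|by lia|].
  by rewrite addnS addn0 => st' t [bldg2 le_t]; split=> //; lia.
by rewrite addn0.
Qed.

Lemma ensures_build_network caps (Ns : seq (seq (option X))) :
  let c := size Ns in
  ensures (build_network m caps Ns) (fun Nm t => exists e,
    [/\ building (c + m + 2) (c + c * m + m) c (Nm.1, e), size Nm.2 <= c * m &
        t <= 50 * (c.+1 * m.+1)]).
Proof.
move=> c; rewrite /build_network.
apply: ensures_bind (ensures_lengthM _) _ => _ t1 [-> le_t1]; rewrite -/c.
run_ops.
apply: ensures_bind (ensures_empty_network _ _ 0) _ => N t2 [Et2 EV wf cap0].
have bldg0 : building (c + m + 2) 0 0 (N, 0) by split=> //; rewrite cap0.
apply: ensures_bind (ensures_add_source_arcs (c := c) _ bldg0) _; first by lia.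
move=> Ne t3 [bldg1 le_t3]; rewrite !add0n in bldg1.
apply: ensures_bind (ensures_add_all_set_arcs (Ns := Ns) (erefl c) _ bldg1) _.
  by lia.
move=> [[Ne' mids] a] t4 [[/= bldg2 le_mids] le_t4].
apply: ensures_bind (ensures_add_group_arcs (c := c) caps _ bldg2) _.
  by lia.
move=> [N' e] t5 [bldg3 le_t5]; apply: ensures_now; exists e; split=> //.
by move: Et2 le_t1 le_t3 le_t4 le_t5; lia.
Qed.

Lemma ensures_selected_points N (mids : seq (nat * X)) :
  ensures (selected_points N mids) (fun _ t => t <= 4 * size mids + 1).
Proof.
apply: ensures_weaken
  (ensures_foreach (c := 3) (I := fun _ _ => True) _ _) _ => //.
  by move=> [e x] l S _; run_ops; apply: ensures_now.
by move=> S t [].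
Qed.

Definition select_by_max_flow (caps : seq nat) (Ns : seq (seq (option X)))
    : delay (seq X) :=
  let* Nm := build_network m caps Ns in
  let: (N, mids) := Nm in
  let* N := ford_fulkerson N 0 1 in
  selected_points N mids.

Lemma ensures_select_by_max_flow caps Ns :
  ensures (select_by_max_flow caps Ns) (fun _ t =>
    t <= 110 * ((size Ns).+1 ^ 2 * m.+1)).
Proof.
set c := size Ns; apply: ensures_bind (ensures_build_network _ _) _.
move=> [N mids] t1 [e [[/= EV wf le_e le_q] le_mids le_t1]].
have sV : 0 < num_nodes N by rewrite EV addn2.
apply: ensures_bind (ensures_ford_fulkerson (t := 1) wf sV _ le_q) _ => //.
move=> N' t2 le_t2.
apply: ensures_weaken (ensures_selected_points _ _) _ => S t3 le_t3.
rewrite -/c in EV le_e le_mids le_t1 le_t2; rewrite EV in le_t2.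
have le_t2' : t2 <= c.+1 * (52 * (c.+1 * m.+1)) + 1.
  by apply: leq_trans le_t2 _; rewrite leq_add2r leq_mul2l; lia.
have : c.+1 * m.+1 <= c.+1 ^ 2 * m.+1 by rewrite leq_mul2r leq_pmulr ?orbT.
by lia.
Qed.

End BuildNetwork.

(** * The programs of the processors and of the coordinator *)

(* The scan of the coordinator adds points in front: [p] was selected before
  [q]. *)
Definition separated (R : numDomainType) (X : Type) (d : X -> X -> R) (rad : R)
    : pred (seq X) :=
  pairwise (fun q p => rad < d p q)%R.

Section AlgorithmTime.
Context (R : realFieldType) (X : Type) (d : X -> X -> R).
Context (m : nat) (g : X -> nat).

Lemma ensures_list_of_table (T : seq (option X)) :
  ensures (list_of_table T) (fun l t => size l <= size T /\ t <= size T + 1).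
Proof.
elim: T => [|o T IH]; apply: ensures_later; first by apply: ensures_now.
apply: ensures_bind IH _ => l t [le_T le_t].
by apply: ensures_now; split; [case: o => /=; lia|rewrite /=; lia].
Qed.

Lemma ensures_farthest tie j dflt (D : seq (X * R)) :
  ensures (farthest tie j dflt D) (fun _ t => t <= 4 * size D + 1).
Proof.
apply: ensures_weaken
  (ensures_foreach (c := 3) (I := fun _ _ => True) _ _) _ => //.
  by move=> [x dx] l [b db] _; run_ops; apply: ensures_now.
by move=> _ t [_]; rewrite size_behead; lia.
Qed.

Lemma ensures_update_distances p (D : seq (X * R)) :
  ensures (update_distances d p D) (fun D' t =>
    size D' = size D /\ t <= 3 * size D + 1).
Proof.
apply: ensures_weaken
  (ensures_mapM (c := 2) (P := predT) (Q := predT) _ (all_predT D)) _.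
  by move=> [x dx] _; run_ops; apply: ensures_now.
by move=> D' t [].
Qed.

Lemma ensures_select_farthest tie dflt c j (D : seq (X * R)) :
  ensures (select_farthest d tie dflt c j D) (fun sel t =>
    [/\ size sel.1 = c, size sel.2 = size D & t <= c * (7 * size D + 3) + 1]).
Proof.
elim: c j D => [|c IH] j D; apply: ensures_later; first by apply: ensures_now.
apply: ensures_bind (ensures_farthest _ _ _ _) _ => pd t1 le_t1.
apply: ensures_bind (ensures_update_distances _ _) _ => D' t2 [szD' le_t2].
apply: ensures_bind (IH _ _) _ => sel t3 []; rewrite szD' => sz1 sz2 le_t3.
by apply: ensures_now; rewrite /= sz1 sz2; split=> //; lia.
Qed.

Lemma ensures_scattered k rad (l : seq X) :
  (forall P, separated d rad P -> size P <= k) ->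
  ensures (scattered d rad l) (fun P t =>
    size P <= k /\ t <= (3 * k + 2) * size l + 1).
Proof.
move=> separated_le; pose far P q := all (fun p => rad < d p q)%R P.
apply: ensures_weaken (ensures_foreach (c := 3 * k + 1)
  (I := fun _ P => separated d rad P) _ _) _ => //.
- move=> q l' P sepP.
  apply: ensures_bind (ensures_foreach (c := 2)
    (I := fun P' b => far P q = b && far P' q) _ _) _ => //.
    by move=> p P' b farE; run_ops; apply: ensures_now; rewrite farE /= andbA.
  move=> b t [farE le_t]; apply: ensures_now; split.
    by case: b farE => //; rewrite /separated /= -/(far P q) => ->.
  by have := separated_le _ sepP; lia.
- by move=> P t [sepP le_t]; split; [exact: separated_le|lia].
Qed.

Hypothesis g_lt : forall x, g x < m.

Lemma ensures_representatives p rad l :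
  ensures (representatives d m g p rad l) (fun T t =>
    size T == m /\ t <= m + 6 * size l + 4).
Proof.
rewrite /representatives.
apply: ensures_bind (ensures_array_new _ _) _ => _ _ [-> ->].
run_ops; apply: ensures_weaken
  (ensures_foreach (c := 5) (I := fun _ T => size T == m) _ _) _.
- move=> x l' T /eqP szT; run_ops; case: ifP => _; last first.
    by apply: ensures_now; rewrite szT.
  run_ops; case: (nth None T _) => [y|].
    by apply: ensures_now; rewrite szT.
  by apply: ensures_op; rewrite size_set_nth_lt szT.
- by rewrite size_set_nth_lt size_nseq.
- by move=> T t [szT le_t]; split=> //; lia.
Qed.

Lemma ensures_processor k tie p1 (Xi : seq X) :
  0 < k -> k <= size Xi ->
  ensures (processor d m g k tie p1 Xi) (fun PL t =>
    [/\ size PL.1 = k, size PL.2 <= k * m & t <= 50 * (k * size Xi + k * m)]).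
Proof.
case: k => [//|k] _ le_k; rewrite /processor; set n := size Xi in le_k *.
apply: ensures_bind
  (ensures_mapM (c := 1) (P := predT) (Q := predT) _ (all_predT Xi)) _.
  by move=> x _; run_ops; apply: ensures_now.
move=> D t1 [szD _ le_t1]; run_ops.
apply: ensures_bind (ensures_select_farthest _ _ _ _ _) _.
move=> [ps D'] t2 [/= szps szD']; rewrite szD -/n => le_t2.
apply: ensures_bind (ensures_farthest _ _ _ _) _ => last t3.
rewrite szD' szD -/n => le_t3; run_ops; set rad := (2 * _)%R.
apply: ensures_bind (ensures_mapM
  (fun p _ => ensures_representatives p rad Xi) (all_predT (p1 :: ps))) _.
rewrite -/n /= szps => tables t4 [sz_tables all_m le_t4].
apply: ensures_bind
  (ensures_mapM (c := m + 1) (Q := fun l => size l <= m) _ all_m) _.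
  by move=> T /eqP szT; have := ensures_list_of_table T; rewrite szT.
move=> lists t5 [sz_lists le_m]; rewrite sz_tables => le_t5.
apply: ensures_bind (ensures_flattenM _) _ => _ t6 [-> Et6].
have := size_flatten_le le_m; rewrite sz_lists sz_tables in Et6 * => le_km.
apply: ensures_now; split=> //=; first by rewrite szps.
have m_gt0 : 0 < m := leq_ltn_trans (leq0n _) (g_lt p1).
rewrite /= in Et6; rewrite -/n in le_t1.
move: le_k le_t1 le_t2 le_t3 le_t4 le_t5 Et6 le_km.
clear - m_gt0; clearbody n.
(* Over successors, the monomials of the bounds occur in the expanded goal. *)
by case: m n m_gt0 => [//|m'] [//|n] _ _; lia.
Qed.

Lemma ensures_coordinator k caps tau (messages : seq (seq X * seq X)) :
  0 < k -> 0 < m -> 0 < size messages ->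
  all (fun PL => (size PL.1 <= k) && (size PL.2 <= k * m)) messages ->
  (forall P, separated d (10 * tau)%R P -> size P <= k) ->
  ensures (coordinator d m g caps tau messages) (fun _ t =>
    t <= 1000 * (m * k ^ 2 * size messages)).
Proof.
move=> k_gt0 m_gt0 l_gt0 le_messages separated_le.
rewrite /coordinator; set l := size messages in l_gt0 *.
apply: ensures_bind
  (ensures_mapM (c := 0) (Q := fun l => size l <= k) _ le_messages) _.
  by move=> PL /andP[le_k _]; apply: ensures_now.
move=> Ps t1 [szPs le_k le_t1].
apply: ensures_bind
  (ensures_mapM (c := 0) (Q := fun l => size l <= k * m) _ le_messages) _.
  by move=> PL /andP[_ le_km]; apply: ensures_now.
move=> Ls t2 [szLs le_km le_t2]; rewrite -/l in szPs szLs le_t1 le_t2.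
apply: ensures_bind (ensures_flattenM _) _ => X' t3 [-> Et3].
apply: ensures_bind (ensures_flattenM _) _ => L t4 [-> Et4].
move: (size_flatten_le le_k) (size_flatten_le le_km) Et3 Et4; rewrite szPs szLs.
move: (flatten Ps) (flatten Ls) => {}X' {}L le_X' le_L Et3 Et4; run_ops.
apply: ensures_bind (ensures_scattered _ separated_le) _ => P t5 [szP le_t5].
apply: ensures_bind (ensures_mapM
  (fun q _ => ensures_representatives q (5 * tau)%R L) (all_predT P)) _.
move=> Ns t6 [szN _ le_t6].
apply: ensures_weaken (ensures_select_by_max_flow m caps Ns) _ => S t7.
rewrite szN => le_t7.
have le_t5' : t5 <= (3 * k + 2) * (l * k) + 1.
  by apply: leq_trans le_t5 _; rewrite leq_add2r leq_mul.
have le_t6' : t6 <= (m + 6 * (l * (k * m)) + 5) * k + 1.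
  by apply: leq_trans le_t6 _; rewrite leq_add2r leq_mul //; lia.
have le_t7' : t7 <= 110 * (k.+1 ^ 2 * m.+1).
  apply: leq_trans le_t7 _.
  by rewrite leq_mul2l leq_mul2r leq_exp2r // ltnS szP orbT.
move: le_X' le_L Et3 Et4 le_t1 le_t2 le_t5' le_t6' le_t7'.
clear - k_gt0 m_gt0 l_gt0; clearbody l.
by case: k m l k_gt0 m_gt0 l_gt0 => [//|k] [//|m'] [//|l] _ _ _; lia.
Qed.

End AlgorithmTime.

(** * Separated points and feasible centers *)

Section Separation.
Context (R : realType) (X : finType) (d : X -> X -> R).
Context (m : nat) (g : X -> 'I_m) (kc : 'I_m -> nat).

Lemma card_feasible S : feasible g kc S -> #|S| <= \sum_j kc j.
Proof.
move=> /forallP fS; rewrite -sum1_card (partition_big g predT) //=.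
apply: leq_sum => j _; apply: leq_trans (fS j).
by rewrite -sum1_card; apply: eq_leq; apply: eq_bigl => x; rewrite inE.
Qed.

Lemma OPT_le_centers tau : (OPT d g kc <= tau%:E)%E ->
  exists (S : {set X}) (center : X -> X), #|S| <= \sum_j kc j /\
    forall x, center x \in S /\ (d (center x) x <= tau)%R.
Proof.
move=> /boolp.bigmin_leP[//|[S fS]].
rewrite /clustering_cost => /bigmax_leP[_ cost_le].
have center_ex x : exists a, a \in S /\ (d a x <= tau)%R.
  have /boolp.bigmin_leP[//|[a aS]] := cost_le x (in_setT x).
  by rewrite lee_fin; exists a.
have [center centerP] := fin_all_exists center_ex.
by exists S, center; split=> //; apply: card_feasible.
Qed.

Lemma OPT_le_ge0 tau (x : X) :
  is_metric d -> (OPT d g kc <= tau%:E)%E -> (0 <= tau)%R.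
Proof.
move=> [d_ge0 _ _ _] /OPT_le_centers[S [center [_ centerP]]].
by have [_] := centerP x; apply: le_trans.
Qed.

Lemma size_separated_le tau rad (P : seq X) :
  is_metric d -> (OPT d g kc <= tau%:E)%E -> (2 * tau <= rad)%R ->
  separated d rad P -> size P <= \sum_j kc j.
Proof.
move=> [_ _ dC d_triangle] /OPT_le_centers[S [center [le_S centerP]]].
move=> tau2_le sepP.
apply: leq_trans le_S; rewrite -(size_map center) cardE.
apply: uniq_leq_size => [|_ /mapP[x _ ->]]; last first.
  by rewrite mem_enum; case: (centerP x).
rewrite uniq_pairwise pairwise_map; apply: sub_pairwise sepP => q p /= far.
have [[_ near_p] [_ near_q]] := (centerP p, centerP q).
apply/eqP => same_center.
have := d_triangle p (center p) q; rewrite (dC p (center p)) -{2}same_center.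
by lra.
Qed.

End Separation.

(** * The running time of an execution *)

Section RunningTime.
Context (R : realType) (E : execution R).

Let n := #|points E|.
Let m := groups E.
Let k := total_capacity E.
Let l := processors E.
Let q := n %/ l.
Let i0 : 'I_l := Ordinal (processors_gt0 E).

Lemma size_part (i : 'I_l) : size (part i) = q.
Proof. by rewrite /q /n -(part_equal i) mulnK // processors_gt0. Qed.

Lemma processors_dvd_points : l %| n.
Proof. by rewrite /n -(part_equal i0) dvdn_mull. Qed.

Lemma groups_gt0 : 0 < m.
Proof. exact: leq_ltn_trans (ltn_ord (group (first_point i0))). Qed.

Lemma size_separated_points_le (P : seq (points E)) :
  separated (@dist R E) (10 * threshold E)%R P -> size P <= k.
Proof.
apply: size_separated_le (dist_metric E) (threshold_ge_OPT E) _.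
have := OPT_le_ge0 (first_point i0) (dist_metric E) (threshold_ge_OPT E).
by lra.
Qed.

Lemma total_capacity_gt0 : 0 < k.
Proof. exact: (size_separated_points_le (P := [:: first_point i0])). Qed.

Lemma takes_processor (i : 'I_l) :
  exists PLt : seq (points E) * seq (points E) * nat,
    [/\ takes (processor_program i) PLt.1 PLt.2,
        (size PLt.1.1 <= k) && (size PLt.1.2 <= k * m) &
        PLt.2 <= 50 * (k * q + k * m)].
Proof.
have le_k : k <= size (part i).
  by apply: leq_trans (part_large i); rewrite addn1.
have [PL [t [PL_t [szP szL]]]] := ensures_processor (@dist R E)
  (fun x => ltn_ord (group x)) (tie_break i) (first_point i)
  total_capacity_gt0 le_k.
by rewrite size_part => le_t; exists (PL, t); split; rewrite //= szP leqnn.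
Qed.

Lemma ex_running_time_leq : exists2 T, running_time E T &
  T <= 1050 * (k * q + m * k ^ 2 * l).
Proof.
have [PLt PLtP] := fin_all_exists takes_processor.
pose messages i := (PLt i).1.
have [|||S [tc [S_tc le_tc]]] := @ensures_coordinator R _ (@dist R E) m _
  (fun x => ltn_ord (group x)) k [seq capacity j | j <- enum 'I_m] (threshold E)
  [seq messages i | i <- enum 'I_l] total_capacity_gt0 groups_gt0.
- by rewrite size_map size_enum_ord processors_gt0.
- by rewrite all_map; apply/allP => i _ /=; case: (PLtP i).
- exact: size_separated_points_le.
exists (\max_i (PLt i).2 + tc).
  by exists messages, (fun i => (PLt i).2), S, tc; split=> // i; case: (PLtP i).
have le_max : \max_i (PLt i).2 <= 50 * (k * q + k * m).
  by apply/bigmax_leqP => i _; case: (PLtP i).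
rewrite size_map size_enum_ord -/l in le_tc.
have le_km : k * m <= m * k ^ 2 * l.
  rewrite mulnC -mulnA leq_mul2l expnS expn1 -mulnA leq_pmulr ?orbT //.
  by rewrite muln_gt0 total_capacity_gt0 processors_gt0.
by lia.
Qed.

End RunningTime.

Local Open Scope ring_scope.

Lemma ex_running_time_ler (R : realType) (E : execution R) :
  exists2 T, running_time E T &
    T%:R <= 1050 * ((total_capacity E)%:R * #|points E|%:R / (processors E)%:R +
      (groups E)%:R * (total_capacity E)%:R ^+ 2 * (processors E)%:R) :> R.
Proof.
have [T time_T le_T] := ex_running_time_leq E; exists T => //.
rewrite -mulrA -natf_div ?processors_dvd_points //.
by rewrite -natrX -!natrM -natrD -natrM ler_nat.
Qed.

Section BalancedParameters.
Context (R : realType) (m k n : R).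
Hypotheses (m_gt0 : 0 < m) (k_gt0 : 0 < k) (n_ge0 : 0 <= n).

Lemma sqrt_ratio_powR : m * k ^+ 2 * Num.sqrt (n / (m * k)) =
  m `^ (1 / 2) * k `^ (3 / 2) * n `^ (1 / 2).
Proof.
have mk_ge0 : 0 <= m * k by rewrite mulr_ge0 ?ltW.
rewrite mul1r (mulrC 3) powRrM powR_mulrn ?powR_ge0 // !powR12_sqrt // ?ltW //.
rewrite sqrtrM // sqrtrV // sqrtrM ?ltW //.
have sqrt_m : m = Num.sqrt m ^+ 2 by rewrite sqr_sqrtr ?ltW.
have sqrt_k : k = Num.sqrt k ^+ 2 by rewrite sqr_sqrtr ?ltW.
rewrite {1}sqrt_m {1}sqrt_k.
by field; rewrite !gt_eqF ?sqrtr_gt0.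
Qed.

Lemma balanced_time_le (l c1 c2 : R) : 0 < c1 -> 0 < l ->
  c1 * Num.sqrt (n / (m * k)) <= l -> l <= c2 * Num.sqrt (n / (m * k)) ->
  k * n / l + m * k ^+ 2 * l <=
    (c1^-1 + c2) * (m `^ (1 / 2) * k `^ (3 / 2) * n `^ (1 / 2)).
Proof.
rewrite -sqrt_ratio_powR; set w := Num.sqrt _ => c1_gt0 l_gt0 l_ge l_le.
have nE : n = m * k * w ^+ 2.
  rewrite sqr_sqrtr ?divr_ge0 // ?mulr_ge0 ?ltW //.
  by field; rewrite !gt_eqF.
have mkk_gt0 : 0 < m * k ^+ 2 by rewrite mulr_gt0 ?exprn_gt0.
rewrite mulrDl; apply: lerD; last first.
  by rewrite [leRHS]mulrCA ler_pM2l.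
rewrite ler_pdivrMr // nE.
have -> : k * (m * k * w ^+ 2) = c1^-1 * (m * k ^+ 2 * w) * (c1 * w).
  by field; rewrite gt_eqF.
by rewrite ler_wpM2l // mulr_ge0 ?invr_ge0 ?mulr_ge0 ?sqrtr_ge0 ?ltW.
Qed.

End BalancedParameters.

Theorem theorem3 (R : realType) :
  (exists C : R, forall E : execution R,
    let n := #|points E|%:R : R in
    let m := (groups E)%:R : R in
    let k := (total_capacity E)%:R : R in
    let l := (processors E)%:R : R in
    exists2 T : nat, running_time E T &
      T%:R <= C * (k * n / l + m * k ^+ 2 * l))
  /\
  (forall c1 c2 : R, 0 < c1 -> 0 < c2 ->
    exists C : R, forall E : execution R,
    let n := #|points E|%:R : R in
    let m := (groups E)%:R : R in
    let k := (total_capacity E)%:R : R in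
    let l := (processors E)%:R : R in
    c1 * Num.sqrt (n / (m * k)) <= l ->
    l <= c2 * Num.sqrt (n / (m * k)) ->
    exists2 T : nat, running_time E T &
      T%:R <= C * (m `^ (1 / 2) * k `^ (3 / 2) * n `^ (1 / 2))).
Proof.
split; first by exists 1050 => E; apply: ex_running_time_ler.
move=> c1 c2 c1_gt0 c2_gt0; exists (1050 * (c1^-1 + c2)) => E n m k l l_ge l_le.
have [T time_T le_T] := ex_running_time_ler E; exists T => //.
apply: le_trans le_T _; rewrite -(mulrA 1050) ler_pM2l //.
by apply: balanced_time_le;
  rewrite ?ler0n ?ltr0n ?groups_gt0 ?total_capacity_gt0 ?processors_gt0.
Qed.
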